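(* Let $q$ be a positive integer and let $H$ be a skew type Hadamard matrix of order $q+1$ of the form $H=\begin{pmatrix}1&\mathbf 1^\top\\-\mathbf 1& I_q+Q\end{pmatrix}$, where $\mathbf 1$ is the all-ones column vector of length $q$ and $Q$ is a $q\times q$ matrix. Let $C=H-I_{q+1}$ and define the $q(q+1)\times q(q+1)$ matrix $M=-I_{q+1}\otimes J_q+C\otimes (I_q+Q)$. Then $M$ is a balancedly splittable Hadamard matrix of order $q(q+1)$ with parameters $(q(q+1),q,q,-1)$.
   Context: A Hadamard matrix of order $n$ is an $n\times n$ $\{1,-1\}$-matrix $H$ with $HH^\top=nI_n$; it is of skew type if $H+H^\top=2I_n$. $J_n$ is the all-ones matrix and $\otimes$ is the Kronecker product. A Hadamard matrix of order $n$ is balancedly splittable with parameters $(n,\ell,a,b)$ if, after permuting its rows, $H=\begin{pmatrix}H_1\\H_2\end{pmatrix}$ with $H_1$ an $\ell\times n$ matrix such that $H_1^\top H_1=\ell I_n+aA+b(J_n-A-I_n)$ for a symmetric $(0,1)$-matrix $A$ with zero diagonal. *)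

(* Defs.v *)
From mathcomp Require Import all_boot all_order fingroup perm all_algebra.
From mathcomp Require Import mxtens.

Set Implicit Arguments.
Unset Strict Implicit.
Unset Printing Implicit Defensive.

Import GRing.Theory.
Local Open Scope ring_scope.

Definition hadamard (n : nat) (H : 'M[int]_n) : Prop :=
  (forall i j, H i j = 1 \/ H i j = -1) /\ H *m H^T = (n%:R)%:M.

Definition skew_type_hadamard (n : nat) (H : 'M[int]_n) : Prop :=
  hadamard H /\ H + H^T = (2%:R)%:M.

Definition all_ones (m n : nat) : 'M[int]_(m, n) := const_mx 1.

Definition zero_one_mx (n : nat) (A : 'M[int]_n) : Prop :=
  forall i j, A i j = 0 \/ A i j = 1.

(* The cast identifies the row indices 'I_(l + k) of the stacked matrix
   with 'I_n. *)
Definition balancedly_splittable_hadamard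
    (n l : nat) (a b : int) (H : 'M[int]_n) : Prop :=
  hadamard H /\
  exists (k : nat) (e : (l + k)%N = n) (s : 'S_n)
         (H1 : 'M[int]_(l, n)) (H2 : 'M[int]_(k, n)),
    row_perm s H = castmx (e, erefl n) (col_mx H1 H2) /\
    exists A : 'M[int]_n,
      [/\ zero_one_mx A, A^T = A, (forall i, A i i = 0)
        & H1^T *m H1 = (l%:R)%:M + a *: A + b *: (all_ones n n - A - 1%:M)].
Arguments balancedly_splittable_hadamard : clear implicits.

(* Main.v *)
Require Import Defs.
From mathcomp Require Import all_boot all_order fingroup perm all_algebra.
From mathcomp Require Import mxtens ring.

(** The core [K = 1 + Q] satisfies [K J = J = J K] and
    [K K^T = K^T K = (q + 1) I - J], while [C] is skew with [C C^T = q I].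
    In [M M^T] the mixed terms add up to [- (C + C^T) (x) J = 0] and the others
    to [I (x) q J + q I (x) ((q + 1) I - J) = q (q + 1) I].  The first block of
    rows is [(-J, K, ..., K)], whose Gram matrix has the blocks [q J], [-J] and
    [(q + 1) I - J], hence off-diagonal entries [q] and [-1] only. *)

Set Implicit Arguments.
Unset Strict Implicit.
Unset Printing Implicit Defensive.

Import GRing.Theory.

Local Open Scope ring_scope.

Section TensorProduct.

Variable R : pzRingType.

Lemma tensmxDl (m n p q : nat) (A B : 'M[R]_(m, n)) (D : 'M[R]_(p, q)) :
  (A + B) *t D = A *t D + B *t D.
Proof. by apply/matrixP=> i j; rewrite !mxE mulrDl. Qed.

Lemma tensmxDr (m n p q : nat) (A : 'M[R]_(m, n)) (B D : 'M[R]_(p, q)) :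
  A *t (B + D) = A *t B + A *t D.
Proof. by apply/matrixP=> i j; rewrite !mxE mulrDr. Qed.

Lemma tens_scalar_mxE (n p q : nat) (a : R) (B : 'M[R]_(p, q)) :
  (a%:M : 'M_n) *t B = 1%:M *t (a *: B).
Proof. by apply/matrixP=> i j; rewrite !mxE !mulrnAl mul1r. Qed.

Lemma tens_1_scalar_mx (n p : nat) (a : R) :
  (1%:M : 'M_n) *t (a%:M : 'M_p) = a%:M.
Proof.
apply/matrixP=> r s.
case: (mxtens_indexP r) (mxtens_indexP s) => i j [k l].
rewrite tensmxE !mxE (can_eq (@mxtens_indexK _ _)) xpair_eqE.
by case: (i == k); rewrite /= ?mul1r ?mul0r.
Qed.

(* The dimensions [(1 + m) * p] and [p + m * p] are convertible, so the first
   [p] rows of [A *t B] can be taken without a cast. *)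
Lemma usubmx_tensmxE (m n p q : nat) (A : 'M[R]_(1 + m, n))
    (B : 'M[R]_(p, q)) (i : 'I_p) (j : 'I_n) (k : 'I_q) :
  usubmx (A *t B : 'M_(p + m * p, _)) i (mxtens_index (j, k)) =
  usubmx A ord0 j * B i k.
Proof.
rewrite mxE [in RHS]mxE.
have -> : lshift (m * p) i = mxtens_index (lshift m ord0 : 'I_(1 + m), i).
  exact: val_inj.
exact: tensmxE.
Qed.

End TensorProduct.

Lemma mul_tr_usubmx_tens (R : comPzRingType) (m n p q : nat)
    (A A' : 'M[R]_(1 + m, n)) (B B' : 'M[R]_(p, q)) :
  (usubmx (A *t B : 'M_(p + m * p, _)))^T
    *m usubmx (A' *t B' : 'M_(p + m * p, _)) =
  ((usubmx A)^T *m usubmx A') *t (B^T *m B').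
Proof.
apply/matrixP=> r s.
case: (mxtens_indexP r) (mxtens_indexP s) => i j [k l].
rewrite tensmxE !mxE big_ord1 mulr_sumr; apply: eq_bigr => t _.
by rewrite mxE !usubmx_tensmxE !mxE; ring.
Qed.

Definition sign_mx (m n : nat) (A : 'M[int]_(m, n)) : Prop :=
  forall i j, A i j = 1 \/ A i j = -1.

Lemma sign_mx_gram_diag (m n : nat) (A : 'M[int]_(m, n)) (i : 'I_n) :
  sign_mx A -> (A^T *m A) i i = m%:R.
Proof.
move=> sgnA; rewrite mxE -[m in RHS]card_ord -sumr_const; apply: eq_bigr => k _.
by rewrite mxE; case: (sgnA k i) => ->.
Qed.

Lemma sym_mx_two_offdiag_values (n : nat) (d a b : int) (G : 'M[int]_n) :
  G^T = G -> (forall i, G i i = d) ->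
  (forall i j, i != j -> G i j = a \/ G i j = b) ->
  exists A : 'M[int]_n,
    [/\ zero_one_mx A, A^T = A, forall i, A i i = 0
      & G = d%:M + a *: A + b *: (all_ones n n - A - 1%:M)].
Proof.
move=> symG diagG offG.
exists (\matrix_(i, j) ((i != j) && (G i j == a))%:R); split.
- by move=> i j; rewrite mxE; case: (_ && _); [right | left].
- by apply/matrixP=> i j; rewrite !mxE eq_sym -[in LHS]symG mxE.
- by move=> i; rewrite mxE eqxx.
apply/matrixP=> i j; rewrite !mxE.
have [->|neq_ij] := eqVneq i j; first by rewrite diagG /=; ring.
by case: eqP => [->|neq_a] /=; [|case: (offG i j neq_ij) => // ->]; ring.
Qed.

Lemma balancedly_splittable_of_gram (l k : nat) (a b : int)
    (M : 'M[int]_(l + k)) :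
  hadamard M ->
  (forall i j, i != j -> ((usubmx M)^T *m usubmx M) i j = a \/
                         ((usubmx M)^T *m usubmx M) i j = b) ->
  balancedly_splittable_hadamard (l + k) l a b M.
Proof.
move=> hadM offG; split=> //; exists k, erefl, 1%g, (usubmx M), (dsubmx M).
split; first by rewrite row_perm1 castmx_id vsubmxK.
apply: sym_mx_two_offdiag_values => //; first by rewrite trmx_mul trmxK.
by move=> i; apply: sign_mx_gram_diag => r j; rewrite mxE; apply: hadM.1.
Qed.

Lemma mul_all_ones (m n p : nat) :
  all_ones m n *m all_ones n p = n%:R *: all_ones m p.
Proof.
apply/matrixP=> i j; rewrite !mxE mulr1 -[n in RHS]card_ord -sumr_const.
by apply: eq_bigr => k _; rewrite !mxE mulr1.
Qed.

Lemma tr_all_ones (m n : nat) : (all_ones m n)^T = all_ones n m.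
Proof. exact: trmx_const. Qed.

Definition skew_conference (n : nat) (C : 'M[int]_n) : Prop :=
  [/\ forall i, C i i = 0,
      forall i j, i != j -> C i j = 1 \/ C i j = -1,
      C + C^T = 0
    & C *m C^T = (n%:R - 1)%:M].

Lemma skew_type_hadamard_diag (n : nat) (H : 'M[int]_n) (i : 'I_n) :
  skew_type_hadamard H -> H i i = 1.
Proof.
case=> -[sgnH _] /matrixP/(_ i i); rewrite !mxE eqxx.
by case: (sgnH i i) => ->.
Qed.

Lemma skew_conference_of_hadamard (n : nat) (H : 'M[int]_n) :
  skew_type_hadamard H -> skew_conference (H - 1%:M).
Proof.
move=> skewH; have [[sgnH gramH] addHT] := skewH.
split=> [i|i j /negPf neq_ij||].
- by rewrite !mxE eqxx skew_type_hadamard_diag.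
- by rewrite !mxE neq_ij subr0.
- by rewrite linearB /= trmx1 addrACA addHT -opprD mulr2n raddfD subrr.
rewrite linearB /= trmx1 mulmxBl !mulmxBr gramH mulmx1 !mul1mx.
rewrite -(addrK H H^T) [H^T + H]addrC addHT.
by apply/matrixP=> i j; rewrite !mxE; ring.
Qed.

Definition skew_core (q : nat) (K : 'M[int]_q) : Prop :=
  [/\ sign_mx K,
      K + K^T = 2%:R%:M,
      K *m all_ones q 1 = all_ones q 1
    & K *m K^T = (1 + q)%:R%:M - all_ones q q].

Lemma skew_core_of_hadamard (q : nat) (K : 'M[int]_q) :
  skew_type_hadamard (block_mx (1%:M : 'M[int]_1) (all_ones 1 q)
                               (- all_ones q 1) K) ->
  skew_core K.
Proof.
set H := block_mx _ _ _ _ => -[[sgnH gramH] addHT].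
move: gramH addHT.
rewrite /H tr_block_mx mulmx_block add_block_mx !scalar_mx_block linearN /=.
rewrite !tr_all_ones trmx1 => /eq_block_mx[_ _ rowK gramK].
move=> /eq_block_mx[_ _ _ addKT]; split=> //.
- by move=> i j; have := sgnH (rshift 1 i) (rshift 1 j); rewrite block_mxEdr.
- by apply/eqP; rewrite -subr_eq0 addrC -rowK mulmx1.
by rewrite -gramK mulNmx mulmxN opprK mul_all_ones scale1r addrAC subrr add0r.
Qed.

Lemma tr_skew_core (q : nat) (K : 'M[int]_q) : skew_core K -> skew_core K^T.
Proof.
case=> sgnK addKT rowK gramK.
have KTE : K^T = 2%:R%:M - K by rewrite -addKT addrC addKr.
split; rewrite ?trmxK.
- by move=> i j; rewrite mxE.
- by rewrite addrC.
- by rewrite KTE mulmxBl rowK mul_scalar_mx scaler_nat mulr2n addrK.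
by rewrite -gramK KTE mulmxBl mulmxBr scalar_mxC.
Qed.

Lemma skew_core_mul_ones (q : nat) (K : 'M[int]_q) (n : nat) :
  skew_core K -> K *m all_ones q n = all_ones q n.
Proof.
case=> _ _ rowK _.
have -> : all_ones q n = all_ones q 1 *m all_ones 1 n.
  by rewrite mul_all_ones scale1r.
by rewrite mulmxA rowK.
Qed.

Lemma skew_core_ones_mul (q : nat) (K : 'M[int]_q) (n : nat) :
  skew_core K -> all_ones n q *m K = all_ones n q.
Proof.
move=> /tr_skew_core coreKT; apply: trmx_inj.
by rewrite trmx_mul !tr_all_ones skew_core_mul_ones.
Qed.

Definition conference_tens_core (q : nat) (C : 'M[int]_(1 + q))
    (K : 'M[int]_q) : 'M[int]_((1 + q) * q) :=
  - (1%:M *t all_ones q q) + C *t K.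

Section ConferenceTensorCore.

Variables (q : nat) (C : 'M[int]_(1 + q)) (K : 'M[int]_q).
Hypotheses (confC : skew_conference C) (coreK : skew_core K).

Local Notation M := (conference_tens_core C K).
Local Notation Mtop := (usubmx (M : 'M_(q + q * q, _))).

Lemma sign_conference_tens_core : sign_mx M.
Proof.
have [diagC sgnC _ _] := confC; have [sgnK _ _ _] := coreK.
move=> r s; case: (mxtens_indexP r) (mxtens_indexP s) => i j [k l].
rewrite !(mxE, tensmxE, mxtens_indexK) /=.
have [<-|neq_ik] := eqVneq i k; first by right; rewrite diagC mul0r addr0 mulr1.
rewrite mul0r oppr0 add0r.
by case: (sgnC i k neq_ik) (sgnK j l) => -> [] ->; [left|right|right|left].
Qed.

Lemma mul_tr_conference_tens_core : M *m M^T = ((1 + q) * q)%:R%:M.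
Proof.
have [_ _ skewC gramC] := confC; have [_ _ _ gramK] := coreK.
have -> : M *m M^T = 1%:M *t (q%:R *: all_ones q q)
    - (C + C^T) *t all_ones q q + (C *m C^T) *t (K *m K^T).
  rewrite /conference_tens_core linearD linearN /= !trmx_tens trmx1 tr_all_ones.
  rewrite mulmxDl !mulmxDr !mulNmx !mulmxN !tensmx_mul opprK !mul1mx mulmx1.
  rewrite mul_all_ones (skew_core_mul_ones _ coreK).
  rewrite (skew_core_ones_mul _ (tr_skew_core coreK)) tensmxDl.
  by rewrite opprD [- (C *t _) - _]addrC !addrA.
rewrite skewC tens0mx subr0 gramC gramK natrD [1 + _]addrC addrK.
rewrite (tens_scalar_mxE _ q%:R) -tensmxDr scalerBr subrKC scale_scalar_mx.
by rewrite tens_1_scalar_mx natrM natrD mulrC [1 + _]addrC.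
Qed.

Lemma hadamard_conference_tens_core : hadamard M.
Proof.
split; [exact: sign_conference_tens_core | exact: mul_tr_conference_tens_core].
Qed.

Hypothesis topC : usubmx C = row_mx 0 (all_ones 1 q).

Lemma gram_usubmx_conference_tens_core :
  Mtop^T *m Mtop =
    block_mx (1%:M : 'M_1) 0 0 0 *t (q%:R *: all_ones q q)
    - block_mx 0 (all_ones 1 q) (all_ones q 1) 0 *t all_ones q q
    + block_mx (0 : 'M_1) 0 0 (all_ones q q)
      *t ((1 + q)%:R%:M - all_ones q q).
Proof.
have [_ _ _] := tr_skew_core coreK; rewrite trmxK => gramKT.
rewrite /conference_tens_core linearD linearN /=.
rewrite ![in _^T]linearD /= ![in _^T]linearN /=.
rewrite mulmxDl !mulmxDr !mulNmx !mulmxN opprK !mul_tr_usubmx_tens.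
rewrite tr_all_ones mul_all_ones gramKT topC.
rewrite (skew_core_ones_mul _ coreK).
rewrite (skew_core_mul_ones _ (tr_skew_core coreK)).
rewrite scalar_mx_block block_mxEv col_mxKu !tr_row_mx trmx1 !trmx0 tr_all_ones.
rewrite !mul_col_row !mul1mx !mulmx1 !mul0mx !mulmx0 mul_all_ones scale1r.
have -> : block_mx 0 (all_ones 1 q) (all_ones q 1) 0 =
    block_mx 0 (all_ones 1 q) 0 0 + block_mx 0 0 (all_ones q 1) 0.
  by rewrite add_block_mx !addr0 !add0r.
by rewrite tensmxDl opprD !addrA.
Qed.

Lemma gram_usubmx_conference_tens_core_values (r s : 'I_((1 + q) * q)) :
  (Mtop^T *m Mtop) r s = q%:Z \/ (Mtop^T *m Mtop) r s = -1.
Proof.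
rewrite -natz gram_usubmx_conference_tens_core.
case: (mxtens_indexP r) (mxtens_indexP s) => c d [c' d'].
rewrite ![_ (mxtens_index _) _]mxE !mxtens_indexK /=.
case: (split_ordP c) (split_ordP c') => i -> [] k ->;
  rewrite !(block_mxEul, block_mxEur, block_mxEdl, block_mxEdr) !mxE.
- by left; rewrite !ord1 eqxx /=; ring.
- by right; ring.
- by right; ring.
by rewrite natrD; case: (d == d') => /=; [left | right]; ring.
Qed.

Lemma balancedly_splittable_conference_tens_core :
  balancedly_splittable_hadamard ((1 + q) * q) q q%:Z (-1) M.
Proof.
apply: (@balancedly_splittable_of_gram q (q * q)) => [|r s _].
  exact: hadamard_conference_tens_core.
exact: gram_usubmx_conference_tens_core_values.
Qed.

End ConferenceTensorCore.

Theorem theorem3p8 (q : nat) (q_gt0 : (0 < q)%N)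
    (H : 'M[int]_(1 + q)) (Q : 'M[int]_q)
    (skewH : skew_type_hadamard H)
    (formH : H = block_mx (1%:M : 'M[int]_1) (all_ones 1 q)
                          (- all_ones q 1) (1%:M + Q)) :
  let C := H - 1%:M in
  let M := - ((1%:M : 'M[int]_(1 + q)) *t all_ones q q) + C *t (1%:M + Q) in
  balancedly_splittable_hadamard ((1 + q) * q)%N q q%:Z (-1) M.
Proof.
move=> C M; apply: balancedly_splittable_conference_tens_core.
- exact: skew_conference_of_hadamard.
- by apply: skew_core_of_hadamard; rewrite -formH.
rewrite /C formH scalar_mx_block opp_block_mx add_block_mx block_mxEv col_mxKu.
by rewrite subrr subr0.
Qed.
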